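(* Assume Martin's axiom and the negation of the continuum hypothesis (MA+$\neg$CH). Suppose that $X$ is a Banach space whose density is smaller than $\mathfrak{c}$ and has uncountable cofinality, and that the dual unit ball $B_{X^*}$ is separable in the weak$^*$ topology. Then $X$ does not admit an overcomplete set.
   Context: All Banach spaces are infinite dimensional and over the reals. $dens(X)$ (the density) is the minimal cardinality of a norm dense subset of $X$; $\mathfrak{c}=|\mathbb{R}|$. A subset $Y$ of a Banach space $X$ is called overcomplete (in $X$) if $|Y|=dens(X)$ and every $Z\subseteq Y$ with $|Z|=|Y|$ is linearly dense in $X$ (its linear span is norm dense in $X$). MA: for every partial order with the countable chain condition and every family of fewer than $\mathfrak{c}$ dense subsets there is a filter meeting all of them. *)

(* Defs.v *)
From HB Require Import structures.
From mathcomp Require Import all_boot all_order all_algebra.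
From mathcomp Require Import all_classical all_reals all_analysis.
From mathcomp Require wochoice.
Import Order.TTheory GRing.Theory Num.Theory.
Import numFieldNormedType.Exports.

Set Implicit Arguments.
Unset Strict Implicit.
Unset Printing Implicit Defensive.

Local Open Scope classical_set_scope.
Local Open Scope card_scope.
Local Open Scope ring_scope.

(* Following cardinality.v, a cardinal is represented by any set having that
   cardinality; the cardinal of the continuum is represented by [set: R]. *)
Definition card_lt (T U : Type) (A : set T) (B : set U) : Prop :=
  (A #<= B) /\ ~ (B #<= A).

(* The order type of (K, r) is the initial ordinal |K|: r well-orders K and
   every proper initial segment of K has cardinality smaller than K. *)
Definition initial_well_order (T : Type) (K : set T) (r : rel T) : Prop :=
  wochoice.wo_chain r (mem K) /\
  forall a, K a -> card_lt [set b | [/\ K b, r b a & b <> a]] K.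

Definition cofinal_in (T : Type) (K : set T) (r : rel T) (C : set T) : Prop :=
  C `<=` K /\ forall a, K a -> exists2 c, C c & r a c.

(* cf(|K|) > omega: no countable subset is cofinal in the initial ordinal |K|,
   which is unique up to order isomorphism. *)
Definition uncountable_cofinality (T : Type) (K : set T) : Prop :=
  exists2 r : rel T, initial_well_order K r &
    forall C : set T, cofinal_in K r C -> ~ countable C.

Definition CH (R : realType) : Prop :=
  forall A : set R, countable A \/ A #= [set: R].

Section PartialOrders.
Context {P : Type} (le : P -> P -> Prop).

Definition is_partial_order : Prop :=
  [/\ forall p, le p p,
      forall p q, le p q -> le q p -> p = q &
      forall p q r, le p q -> le q r -> le p r].

Definition compatible (p q : P) : Prop := exists r, le r p /\ le r q.

Definition antichain (A : set P) : Prop :=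
  forall p q, A p -> A q -> p <> q -> ~ compatible p q.

Definition ccc : Prop := forall A : set P, antichain A -> countable A.

Definition order_dense (D : set P) : Prop :=
  forall p, exists2 d, D d & le d p.

Definition order_filter (G : set P) : Prop :=
  [/\ G !=set0,
      forall p q, G p -> le p q -> G q &
      forall p q, G p -> G q -> exists2 r, G r & le r p /\ le r q].

End PartialOrders.

(* Partial orders are required to be inhabited: the empty one has no filter. *)
Definition MA (R : realType) : Prop :=
  forall (P : Type) (le : P -> P -> Prop),
    inhabited P -> is_partial_order le -> ccc le ->
  forall F : set (set P),
    card_lt F [set: R] -> (forall D, F D -> order_dense le D) ->
  exists2 G : set P, order_filter le G & forall D, F D -> D `&` G !=set0.

Section BanachSpaces.
Context {R : realType}.

Definition linear_span (X : lmodType R) (S : set X) : set X :=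
  [set x | exists (n : nat) (c : 'I_n -> R) (v : 'I_n -> X),
     (forall i, S (v i)) /\ x = \sum_(i < n) c i *: v i].

Definition infinite_dimensional (X : lmodType R) : Prop :=
  ~ exists2 S : set X, finite_set S & linear_span S = [set: X].

Definition linearly_dense (X : normedModType R) (S : set X) : Prop :=
  dense (linear_span S).

(* |K| = dens(X) *)
Definition has_density (X : normedModType R) (T : Type) (K : set T) : Prop :=
  (exists2 D : set X, dense D & D #= K) /\
  forall D : set X, dense D -> K #<= D.

Definition overcomplete (X : normedModType R) (Y : set X) : Prop :=
  has_density X Y /\
  forall Z : set X, Z `<=` Y -> Z #= Y -> linearly_dense Z.

(* The weak* topology of the dual is the topology of pointwise convergence on
   X, so the dual is taken as a subset of the product space X -> R. *)
Definition dual (X : normedModType R) : set {ptws X -> R} :=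
  [set f | linear (f : X -> R^o) /\ continuous (f : X -> R^o)].
Arguments dual X : clear implicits.

Definition dual_norm (X : normedModType R) (f : X -> R) : R :=
  sup [set `|f x| | x in [set x : X | `|x| <= 1]].

Definition dual_unit_ball (X : normedModType R) : set {ptws X -> R} :=
  [set f | dual X f /\ dual_norm f <= 1].

End BanachSpaces.
Arguments dual {R} X.
Arguments dual_unit_ball {R} X.

(* A is separable in the subspace topology. *)
Definition separable_set (T : topologicalType) (A : set T) : Prop :=
  exists S : set T, [/\ countable S, S `<=` A & A `<=` closure S].

(* Main.v *)
(* Write kappa for dens(X) and let Y be overcomplete.  Some Z in Y of size kappa
   is separated: for a fixed e > 0, every nonempty finite subset of Z contains a
   point at distance at least e from the span of the other points; otherwise
   maximal separated subsets for e = 1/(k+1) would together give a linearly dense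
   set of size smaller than kappa.  Since the norms on Z may be assumed bounded, a
   functional of size eta on m points of Z has norm at most C(m) eta on their span.

   Fix x0 in Z.  Conditions are finite sets A of pairs (n, z) with z in Z such that
   each section A_n satisfies dist(x0, span A_n) > c, ordered by reverse inclusion.
   By Hahn-Banach and weak* density, the inequality for A_n is witnessed by a
   functional from a countable family that is tiny on A_n; two conditions with the
   same witnesses are compatible, because the same functional is tiny on the union.
   So the order is sigma-linked.  A generic filter yields sets H_n covering Z with
   dist(x0, span H_n) >= c, and by uncountable cofinality some H_n has size kappa. *)
Require Import Defs.
From HB Require Import structures.
From mathcomp Require Import all_boot all_order all_algebra.
From mathcomp Require Import all_classical all_reals all_analysis.
From mathcomp Require Import finmap.
From mathcomp Require wochoice.
From mathcomp Require Import ring lra.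
Import Order.TTheory GRing.Theory Num.Theory.
Import numFieldNormedType.Exports.

Local Open Scope classical_set_scope.
Local Open Scope card_scope.
Local Open Scope ring_scope.

(** * Well-orders and infinite cardinals *)

Lemma card_le_inj {T U} {A : set T} {B : set U} (f : T -> U) :
  set_fun A B f -> set_inj A f -> A #<= B.
Proof.
move=> fAB fI; have : exists2 g : T -> U, set_fun A B g & set_inj A g.
  by exists f.
by case/injfunPex => g; exact: inj_card_le g.
Qed.

Lemma card_le_ex {T U} {A : set T} {B : set U} (u : U) :
  A #<= B -> exists2 f : T -> U, set_fun A B f & set_inj A f.
Proof.
elim/Ppointed: U u B => U u B; first by case: (no u).
by move=> /pcard_leP/injfunPex.
Qed.

Section WellOrder.
Context {T : Type} {K : set T} {r : rel T}.
Hypothesis rK : wochoice.wo_chain r (mem K).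

Lemma wo_min (A : set T) : A `<=` K -> A !=set0 ->
  exists2 z, A z & forall x, A x -> r z x.
Proof.
move=> AK [a Aa]; have AK' : sub_mem (mem (mem A)) (mem (mem K)).
  by move=> x /set_mem/AK; exact: mem_set.
have [|z [[/set_mem Az zmin] _]] := rK _ AK'; first by exists a; exact: mem_set.
by exists z => // x Ax; apply: zmin; exact: mem_set.
Qed.

(** [wo_chain] only says that every nonempty subset has a unique least element; the order axioms
    come from applying this to sets of at most three points. *)
Lemma wo_refl a : K a -> r a a.
Proof.
by move=> Ka; have [||_ -> ->//] := @wo_min [set a]; [move=> ? ->|exists a].
Qed.

Lemma wo_total a b : K a -> K b -> r a b \/ r b a.
Proof.
move=> Ka Kb; have [||z [->|->] zmin] := @wo_min [set a; b].
- by move=> ? [->|->].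
- by exists a; left.
- by left; apply: zmin; right.
- by right; apply: zmin; left.
Qed.

Lemma wo_antisym a b : K a -> K b -> r a b -> r b a -> a = b.
Proof.
move=> Ka Kb rab rba; have AK : sub_mem (mem (mem [set a; b])) (mem (mem K)).
  by move=> x /set_mem[->|->]; exact: mem_set.
have [|z [_ uz]] := rK _ AK; first by exists a; apply: mem_set; left.
have min_of x : (x = a \/ x = b) -> z = x.
  move=> xab; apply: uz; split; first exact: mem_set.
  by move=> y /set_mem yab; case: xab yab => -> [->|->] //; exact: wo_refl.
by rewrite -(min_of a) ?(min_of b)//; [right|left].
Qed.

Lemma wo_trans a b c : K a -> K b -> K c -> r a b -> r b c -> r a c.
Proof.
move=> Ka Kb Kc rab rbc.
have [||z zabc zmin] := @wo_min [set x | [\/ x = a, x = b | x = c]].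
- by move=> ? [->|->|->].
- by exists a; apply: Or31.
have za : r z a by apply: zmin; apply: Or31.
have zb : r z b by apply: zmin; apply: Or32.
have zc : r z c by apply: zmin; apply: Or33.
case: zabc => z_eq; subst z => //.
- by rewrite (wo_antisym a b).
- by rewrite -(wo_antisym b c Kb Kc rbc zb).
Qed.

Definition segment a := [set b | [/\ K b, r b a & b <> a]].

Lemma subset_segment a b : K a -> K b -> r a b -> segment a `<=` segment b.
Proof.
move=> Ka Kb rab c [Kc rca ca]; split => //; first exact: (wo_trans c a b).
by move=> cb; apply: ca; apply: wo_antisym => //; rewrite cb.
Qed.

Lemma segment_wf : well_founded (fun b a => K a /\ segment a b).
Proof.
move=> a; apply/not_notP => accNa.
pose B := K `&` [set b | ~ Acc (fun b a => K a /\ segment a b) b].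
have [||z [Kz accNz] zmin] := @wo_min B.
- by move=> ? [].
- exists a; split => //=; apply/not_notP => KNa.
  by apply: accNa; constructor => b [].
apply: accNz; constructor => b [_ [Kb rbz bz]].
apply/not_notP => accNb; apply: bz.
by apply: wo_antisym => //; apply: zmin.
Qed.

(** Transfinite recursion: [phi a] is a point of [B] outside the image of the segment of [a]. If
    such a point always exists, [phi] embeds [K] in [B]; otherwise the image of some segment covers
    [B]. *)
Lemma card_le_segment {U} (B : set U) : K !=set0 -> ~ (K #<= B) ->
  exists2 a, K a & B #<= segment a.
Proof.
move=> [a0 Ka0] KB; have [->|/set0P[u0 Bu0]] := eqVneq B set0.
  by exists a0.
pose pick (P : set U) : U :=
  if pselect (exists u, P u) is left h then projT1 (cid h) else u0.
have pickP P : P !=set0 -> P (pick P).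
  by move=> P0; rewrite /pick; case: pselect => // h; case: cid.
pose F a (rec : forall b, K a /\ segment a b -> U) : U :=
  pick [set u | B u /\ forall b h, rec b h <> u].
pose phi := Fix segment_wf (fun=> U) F.
have phiE a : K a -> phi a = pick (B `\` (phi @` segment a)).
  move=> Ka; rewrite /phi Fix_eq => [|x f g fg].
    rewrite /F; congr pick; apply/seteqP; split => u [Bu uN]; split => //.
      by move=> [b ab] /(uN b (conj Ka ab)).
    by move=> b [_ ab] ub; apply: uN; exists b.
  rewrite /F; congr pick; apply/seteqP; split => u [Bu uN]; split => // b h.
    by rewrite -fg.
  by rewrite fg.
have [all|] := pselect (forall a, K a -> B `\` (phi @` segment a) !=set0).
  exfalso; apply: KB; apply: (@card_le_inj _ _ _ _ phi).
    by move=> a Ka; rewrite phiE//; have [] := pickP _ (all a Ka).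
  have neq a b : K a -> segment a b -> phi a <> phi b.
    move=> Ka ab; have [_] := pickP _ (all a Ka); rewrite -phiE// => N e.
    by apply: N; exists b.
  move=> a b /set_mem Ka /set_mem Kb ab; apply/not_notP => anb.
  have [rab|rba] := wo_total a b Ka Kb.
    by apply: (neq b a Kb) => //.
  by apply: (neq a b Ka) => //; split => // /esym.
move=> /existsNP[a /not_implyP[Ka aN]]; exists a => //.
apply: card_le_trans (card_image_le phi _).
apply: subset_card_le => u Bu; apply/not_notP => uN.
by apply: aN; exists u.
Qed.

End WellOrder.

(** * Comparability of cardinals and squares of infinite sets *)

(** If [A] does not inject into [B], a well-order of [A] places [B] inside a proper initial segment
    of [A]. *)
Lemma card_le_total {T U} (A : set T) (B : set U) : A #<= B \/ B #<= A.
Proof.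
elim/Peq: T A => T A.
have [AB|NAB] := pselect (A #<= B); [by left|right].
have A0 : A !=set0 by apply/set0P/eqP => A0; apply: NAB; rewrite A0 card_ge0.
have [r rwo] := wochoice.well_ordering_principle T.
have rA : wochoice.wo_chain r (mem A) by move=> C _; exact: rwo.
have [a Aa Ba] := card_le_segment rA B A0 NAB.
by apply: card_le_trans Ba _; apply: subset_card_le => x [].
Qed.

(** Zorn's lemma on infinite subsets [B] of [A] with an injective pairing [f] on [B]. At a maximal
    one, either the rest of [A] is no larger than [B], so that [A] embeds in [B], or it holds a copy
    of [B], and [f] extends to both copies, against maximality. *)
Lemma infinite_square {T} (A : set T) : infinite_set A -> A `*` A #<= A.
Proof.
move=> Ainf; have [a0 Aa0] := infinite_setN0 Ainf.
pose good (p : set T * (T -> T -> T)) :=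
  [/\ p.1 `<=` A, infinite_set p.1,
      forall x y, p.1 x -> p.1 y -> p.1 (p.2 x y) &
      forall x y x' y', p.1 x -> p.1 y -> p.1 x' -> p.1 y' ->
        p.2 x y = p.2 x' y' -> x = x' /\ y = y'].
pose ext (p q : set T * (T -> T -> T)) :=
  p.1 `<=` q.1 /\ forall x y, p.1 x -> p.1 y -> p.2 x y = q.2 x y.
pose R (p q : {p | good p}) := `[< ext (sval p) (sval q) >].
(* A countably infinite subset, paired as the natural numbers are, starts the construction. *)
have [p0 gp0] : exists p, good p.
  have [f fA fI] := card_le_ex a0 (iffLR (infiniteP _) Ainf).
  have fI' m n : f m = f n -> m = n by apply: fI; exact: mem_set.
  pose h : nat * nat -> nat := choice.pickle.
  have hI : injective h by exact: pcan_inj choice.pickleK.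
  have [g gE] : exists g : T -> nat, forall n, g (f n) = n.
    have /choice[g gE] : forall x, exists n, range f x -> f n = x.
      by move=> x; have [[n _ <-]|N] := pselect (range f x); [exists n|exists 0%N].
    by exists g => n; apply: fI'; rewrite gE//; exists n.
  exists (range f, fun x y => f (h (g x, g y))); split => /=.
  - by move=> _ [n _ <-]; exact: fA.
  - apply/infiniteP; apply: (@card_le_inj _ _ _ _ f); last exact: fI.
    by move=> n _; exists n.
  - by move=> ? ? [m _ <-] [n _ <-]; rewrite !gE; exists (h (m, n)).
  - move=> ? ? ? ? [m _ <-] [n _ <-] [m' _ <-] [n' _ <-]; rewrite !gE.
    by move=> /fI' /hI[-> ->].
have [] := @ZL_preorder {p | good p} (exist _ p0 gp0) R.
- by move=> p; apply/asboolP; split.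
- move=> q p s /asboolP[qp fqp] /asboolP[ps fps]; apply/asboolP; split.
    exact: subset_trans ps.
  by move=> x y qx qy; rewrite fqp// fps//; exact: qp.
- move=> C totC; have [->|/set0P[p1 Cp1]] := eqVneq C set0.
    by exists (exist _ p0 gp0).
  pose in_ (p : {p | good p}) x y := C p /\ (sval p).1 x /\ (sval p).1 y.
  pose f x y := if pselect (exists p, in_ p x y) is left h
    then (sval (projT1 (cid h))).2 x y else x.
  have fE p x y : C p -> (sval p).1 x -> (sval p).1 y -> f x y = (sval p).2 x y.
    move=> Cp px py; rewrite /f; case: pselect => [h|[]]; last by exists p.
    case: (cid h) => q [/= Cq [qx qy]].
    by have [/asboolP[_ e]|/asboolP[_ e]] := totC _ _ Cp Cq; rewrite e.
  pose B := \bigcup_(p in C) (sval p).1.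
  have common x y : B x -> B y -> exists2 p, C p & (sval p).1 x /\ (sval p).1 y.
    move=> [p Cp px] [q Cq qy].
    by have [/asboolP[pq _]|/asboolP[qp _]] := totC _ _ Cp Cq;
      [exists q => //; split => //; exact: pq|
       exists p => //; split => //; exact: qp].
  have common4 x y x' y' : B x -> B y -> B x' -> B y' -> exists2 p, C p &
      [/\ (sval p).1 x, (sval p).1 y, (sval p).1 x' & (sval p).1 y'].
    move=> Bx By Bx' By'; have [p Cp [px py]] := common _ _ Bx By.
    have [q Cq [qx qy]] := common _ _ Bx' By'.
    have [/asboolP[pq _]|/asboolP[qp _]] := totC _ _ Cp Cq.
      by exists q => //; split => //; exact: pq.
    by exists p => //; split => //; exact: qp.
  have gB : good (B, f).
    split => /=.
    - by move=> x [p _]; case: (svalP p) => + _ _ _; apply.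
    - case: (svalP p1) => _ inf _ _; apply: sub_infinite_set inf.
      by move=> x p1x; exists p1.
    - move=> x y Bx By; have [p Cp [px py]] := common _ _ Bx By.
      by rewrite (fE p)//; exists p => //; case: (svalP p) => _ _ + _; apply.
    - move=> x y x' y' Bx By Bx' By'.
      have [p Cp [px py px' py']] := common4 _ _ _ _ Bx By Bx' By'.
      by rewrite !(fE p)//; case: (svalP p) => _ _ _; apply.
  exists (exist _ (B, f) gB) => p Cp; apply/asboolP; split => /=.
    by move=> x px; exists p.
  by move=> x y px py; rewrite (fE p).
move=> [[B f] /= gBf] maxB; case: (gBf) => /= BA Binf fB fI.
have [b0 Bb0] := infinite_setN0 Binf.
have [b1 [Bb1 b01]] : exists b1, B b1 /\ b0 <> b1.
  apply/not_existsP => N; apply: Binf; apply: (@sub_finite_set _ _ [set b0]) => //.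
  by move=> x Bx; apply/not_notP => xb0; apply: (N x); split => // /esym.
(* As B x B embeds in B, so do two disjoint copies of B. *)
have code (E : set T) : E `\` B #<= B ->
    exists2 k : T -> T, set_fun E B k & set_inj E k.
  move=> /(card_le_ex b0)[g gB gI].
  exists (fun x => if pselect (B x) then f x b0 else f (g x) b1).
    move=> x Ex /=; case: pselect => Bx; apply: fB => //.
    by apply: gB.
  move=> x y /set_mem Ex /set_mem Ey.
  have gB' z : E z -> ~ B z -> B (g z) by move=> Ez NBz; apply: gB.
  case: pselect => Bx; case: pselect => By /fI[]//; do ?exact: gB'.
  - by move=> _ /esym /b01.
  by move=> + _; apply: gI; apply: mem_set.
have [AB|BA'] := card_le_total (A `\` B) B.
  have [k kB kI] := code A AB.
  apply: (@card_le_inj _ _ _ _ (fun x => f (k x.1) (k x.2))).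
    by move=> x [Ax1 Ax2]; apply: BA; apply: fB; exact: kB.
  move=> [x y] [x' y'] /set_mem[/= Ax Ay] /set_mem[/= Ax' Ay'] /fI[]; do ?exact: kB.
  by move=> /kI -> => [/kI ->||]//; exact: mem_set.
have [g gA gI] := card_le_ex b0 BA'.
pose E := B `|` g @` B.
have EBB : E `\` B #<= B.
  apply: card_le_trans (card_image_le g B).
  by apply: subset_card_le => x [[]].
have [k kB kI] := code E EBB.
(* Pairs not in the old square are coded in [B] and moved by [g] to the new points, so they cannot
   collide with old values. *)
pose f' x y := if pselect (B x /\ B y) then f x y else g (f (k x) (k y)).
have f'out x y : E x -> E y -> ~ (B x /\ B y) -> B (f (k x) (k y)).
  by move=> Ex Ey _; apply: fB; exact: kB.
have gE : good (E, f').
  split => /=.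
  - by move=> x [/BA//|[y By <-]]; have [] := gA y By.
  - by apply: sub_infinite_set Binf; left.
  - move=> x y Ex Ey; rewrite /f'; case: pselect => [[Bx By]|N]; first by left; exact: fB.
    by right; exists (f (k x) (k y)) => //; exact: f'out.
  - move=> x y x' y' Ex Ey Ex' Ey'; rewrite /f'.
    case: pselect => [[Bx By]|N]; case: pselect => [[Bx' By']|N'] /=.
    + exact: fI.
    + move=> e; have [_ []] := gA _ (f'out _ _ Ex' Ey' N').
      by rewrite -e; exact: fB.
    + move=> e; have [_ []] := gA _ (f'out _ _ Ex Ey N).
      by rewrite e; exact: fB.
    move=> /(gI _ _ (mem_set (f'out _ _ Ex Ey N)) (mem_set (f'out _ _ Ex' Ey' N'))).
    by move=> /fI[]; do ?exact: kB; move=> /kI -> => [/kI ->||]//; exact: mem_set.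
have /asboolP[/= EB _] : R (exist _ (E, f') gE) (exist _ (B, f) gBf).
  apply: maxB; apply/asboolP; split => /=; first by left.
  by move=> x y Bx By; rewrite /f'; case: pselect => // -[].
by have [_ []] := gA b0 Bb0; apply: EB; right; exists b0.
Qed.

(** * Sets smaller than a cardinal of uncountable cofinality *)

Lemma card_le_setX {T T' U} (A : set T) (B : set T') (C : set U) :
  A #<= C -> B #<= C -> A `*` B #<= C `*` C.
Proof.
have [->|/set0P[c Cc]] := eqVneq C set0.
  by rewrite !card_le0 => /eqP-> /eqP->; rewrite setX0.
move=> /(card_le_ex c)[f fC fI] /(card_le_ex c)[g gC gI].
apply: (@card_le_inj _ _ _ _ (fun x => (f x.1, g x.2))).
  by move=> x [Ax Bx]; split; [exact: fC|exact: gC].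
move=> [x y] [x' y'] /set_mem[/= Ax By] /set_mem[/= Ax' By'] [].
by move=> /fI -> => [/gI ->||]//; exact: mem_set.
Qed.

(** By comparability this means that [A] has smaller cardinality than [K]. *)
Definition small {T U} (K : set T) (A : set U) := ~ (K #<= A).

Lemma small_le {T U V} {K : set T} {A : set U} {B : set V} :
  A #<= B -> small K B -> small K A.
Proof. by move=> AB; apply: contra_not => /card_le_trans; apply. Qed.

Lemma small_image {T U V} {K : set T} (f : U -> V) {A : set U} :
  small K A -> small K (f @` A).
Proof. exact: small_le (card_image_le _ _). Qed.

Section SmallSets.
Context {T : Type} {K : set T}.
Hypothesis cofK : uncountable_cofinality K.

Lemma uncountable_cofinality_uncountable : ~ countable K.
Proof.
have [r [rK _] /(_ K)] := cofK; apply; split => // a Ka.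
by exists a => //; exact: (wo_refl rK).
Qed.

Lemma small_countable {U} (A : set U) : countable A -> small K A.
Proof.
move=> cA KA; apply: uncountable_cofinality_uncountable.
exact: sub_countable cA.
Qed.

Lemma uncountable_cofinality_nonempty : K !=set0.
Proof.
apply/set0P/eqP => K0; apply: uncountable_cofinality_uncountable.
by rewrite K0.
Qed.

(** Each [F n] fits in the segment of some [a n]. The countable range of [a] is not cofinal, so some
    [c] bounds it, and the segment of [c] is small because the order is initial. *)
Lemma small_bound {U} (F : nat -> set U) : (forall n, small K (F n)) ->
  exists c : T, exists2 S : set T, small K S & forall n, F n #<= S.
Proof.
move=> Fs; have [r [rK rini] cof] := cofK.
have /choice[a Fa] : forall n, exists a, K a /\ F n #<= segment (K := K) (r := r) a.
  move=> n; have [a Ka Fa] := card_le_segment rK (F n)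
    uncountable_cofinality_nonempty (Fs n).
  by exists a.
have [c [Kc ac]] : exists c, K c /\ forall n, r (a n) c.
  apply/not_existsP => N; have : countable (range a).
    by apply: card_le_trans (card_image_le _ _) _; exact: countableP.
  apply: cof; split; first by move=> _ [n _ <-]; have [] := Fa n.
  move=> c Kc; apply/not_notP => Nc; apply: (N c); split => // n.
  have [Kan _] := Fa n.
  have [//|rca] := wo_total rK (a n) c Kan Kc.
  by exfalso; apply: Nc; exists (a n); [exists n|].
exists c, (segment (K := K) (r := r) c); first by have [] := rini c Kc.
move=> n; have [Kan Fan] := Fa n; apply: card_le_trans Fan _.
exact: subset_card_le (subset_segment rK (a n) c Kan Kc (ac n)).
Qed.

Lemma small_square {U} (A : set U) : small K A -> small K (A `*` A).
Proof.
move=> As; have [fA|iA] := pselect (finite_set A).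
  by apply: small_countable; apply: finite_set_countable; exact: finite_setX.
exact: small_le (infinite_square A iA) As.
Qed.

(** A common small set [S] receives both factors, which reduces the claim to the square of [S]; the
    sum type makes one sequence of sets from two types. *)
Lemma small_setX {U V} (A : set U) (B : set V) :
  small K A -> small K B -> small K (A `*` B).
Proof.
move=> As Bs.
have [|c [S Ss FS]] := @small_bound (U + V)%type
    (fun n => if n is 0 then inl @` A else inr @` B).
  by move=> [|n]; exact: small_image.
apply: small_le (small_square S Ss); apply: card_le_setX.
  apply: card_le_trans (FS 0%N); apply: (@card_le_inj _ _ _ _ inl).
    by move=> x Ax; exists x.
  by move=> x y _ _ [].
apply: card_le_trans (FS 1%N); apply: (@card_le_inj _ _ _ _ inr).
  by move=> x Ax; exists x.
by move=> x y _ _ [].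
Qed.

(** All [F n] embed in one small [S], so a point of the union is coded by an index and an element of
    [S]. *)
Lemma small_bigcup {U} (F : nat -> set U) :
  (forall n, small K (F n)) -> small K (\bigcup_n F n).
Proof.
move=> /[dup] Fs /small_bound[c [S Ss FS]].
have sN : small K [set: nat] by exact: small_countable.
apply: small_le (small_setX _ _ sN Ss).
have /choice[f fP] : forall n, exists f : U -> T, set_fun (F n) S f /\ set_inj (F n) f.
  by move=> n; have [f ? ?] := card_le_ex c (FS n); exists f.
have /choice[m mP] : forall x, exists n, (\bigcup_n F n) x -> F n x.
  by move=> x; have [[n _ Fnx]|N] := pselect ((\bigcup_n F n) x);
    [exists n|exists 0%N].
apply: (@card_le_inj _ _ _ _ (fun x => (m x, f (m x) x))).
  by move=> x Fx; split => //=; apply: (fP (m x)).1; exact: mP.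
move=> x y /set_mem Fx /set_mem Fy [mxy]; rewrite -mxy.
by apply: (fP (m x)).2; apply: mem_set; [exact: mP|rewrite mxy; exact: mP].
Qed.

Lemma bigcup_not_small {U} (Z : set U) (F : nat -> set U) : K #<= Z ->
  Z `<=` \bigcup_n F n -> exists n, K #<= F n.
Proof.
move=> KZ ZF; apply/not_existsP => /small_bigcup; apply.
by apply: card_le_trans KZ _; exact: subset_card_le.
Qed.

End SmallSets.

(** * Spans and the Hahn-Banach theorem *)

Section Span.
Context {R : realType} {X : lmodType R}.
Implicit Types (S : set X) (x z : X).

Lemma span0 S : linear_span S 0.
Proof.
exists 0%N, (fun=> 0), (fun=> 0); split; first by case.
by rewrite big_ord0.
Qed.

Lemma span_lin S a x z : S z -> linear_span S x -> linear_span S (a *: z + x).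
Proof.
move=> Sz [n [c [v [Sv ->]]]].
exists n.+1, (fun i => if unlift ord0 i is Some j then c j else a),
  (fun i => if unlift ord0 i is Some j then v j else z); split.
  by move=> i; case: unlift.
rewrite big_ord_recl unlift_none; congr (_ + _).
by apply: eq_bigr => i _; rewrite liftK.
Qed.

Lemma span_ind S (P : X -> Prop) : P 0 ->
  (forall a z x, S z -> linear_span S x -> P x -> P (a *: z + x)) ->
  forall x, linear_span S x -> P x.
Proof.
move=> P0 Plin x [n [c [v [Sv ->]]]] {x}.
elim: n c v Sv => [|n IH] c v Sv; first by rewrite big_ord0.
rewrite big_ord_recl; apply: Plin => //; last exact: IH.
by exists n, (fun i => c (lift ord0 i)), (fun i => v (lift ord0 i)).
Qed.

Lemma span_mem S x : S x -> linear_span S x.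
Proof. by move=> Sx; rewrite -[x]addr0 -[x]scale1r; exact/span_lin/span0. Qed.

Lemma spanD S x y : linear_span S x -> linear_span S y -> linear_span S (x + y).
Proof.
move=> + Sy; elim/span_ind: x / => [|a z x Sz _ IH]; first by rewrite add0r.
by rewrite -addrA; exact: span_lin.
Qed.

Lemma spanZ S a x : linear_span S x -> linear_span S (a *: x).
Proof.
elim/span_ind: x / => [|b z x Sz _ IH]; first by rewrite scaler0; exact: span0.
by rewrite scalerDr scalerA; exact: span_lin.
Qed.

Lemma spanS {S S'} : S `<=` S' -> linear_span S `<=` linear_span S'.
Proof.
move=> SS' x; elim/span_ind: x / => [|a z x Sz _ IH]; first exact: span0.
by apply: span_lin => //; exact: SS'.
Qed.

Lemma span_finite S x : linear_span S x ->
  exists2 s : seq X, (forall z, z \in s -> S z) & linear_span [set` s] x.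
Proof.
elim/span_ind: x / => [|a z x Sz _ [s sS sx]]; first by exists [::] => //; exact: span0.
exists (z :: s); first by move=> y; rewrite inE => /orP[/eqP->//|]; exact: sS.
apply: span_lin; first by rewrite /= mem_head.
by apply: spanS sx => y /= ys; rewrite inE ys orbT.
Qed.

Lemma span_setD1 S z x : linear_span S x ->
  exists a t, linear_span (S `\ z) t /\ x = a *: z + t.
Proof.
elim/span_ind: x / => [|b y x Sy _ [a [t [St ->]]]].
  by exists 0, 0; split; [exact: span0|rewrite scale0r addr0].
have [->|yz] := eqVneq y z.
  by exists (b + a), t; split => //; rewrite scalerDl addrA.
exists a, (b *: y + t); split; last by rewrite addrCA.
by apply: span_lin => //; split => //; exact/eqP.
Qed.

Lemma span_nil x : linear_span [set` [::]] x -> x = 0.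
Proof. by elim/span_ind: x /. Qed.

Lemma span_set1 x y : linear_span [set x] y -> exists a, y = a *: x.
Proof.
elim/span_ind: y / => [|b z y -> _ [a ->]]; first by exists 0; rewrite scale0r.
by exists (b + a); rewrite scalerDl.
Qed.

End Span.

(** * Hahn-Banach through minimal sublinear functionals *)

Section HahnBanach.
Context {R : realType} {X : lmodType R}.
Implicit Types (q : X -> R) (x y : X).

(** The inequality for positive scalars suffices: used for [a] and for its inverse, it becomes an
    equality. *)
Definition sublinear q :=
  (forall x y, q (x + y) <= q x + q y) /\
  (forall a x, 0 < a -> q (a *: x) <= a * q x).

(** This serves three infima: tilts, lower bounds of chains in Zorn's lemma, and the distance to a
    span. The minorant [b] keeps the infimum finite. *)
Lemma sublinear_inf {I} (D : set I) (e : I -> X -> R) (b : X -> R) : D !=set0 ->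
  (forall i x, D i -> b x <= e i x) ->
  (forall i j x y, D i -> D j -> exists2 k, D k & e k (x + y) <= e i x + e j y) ->
  (forall i a x, 0 < a -> D i -> exists2 k, D k & e k (a *: x) <= a * e i x) ->
  exists2 q, sublinear q &
    (forall i x, D i -> q x <= e i x) /\
    (forall x c, (forall i, D i -> c <= e i x) -> c <= q x).
Proof.
move=> [i0 Di0] be eD eZ; pose q x := inf [set e i x | i in D].
have qe i x : D i -> q x <= e i x.
  move=> Di; apply: ge_inf; last by exists i.
  by exists (b x) => _ [j Dj <-]; exact: be.
have qc x c : (forall i, D i -> c <= e i x) -> c <= q x.
  move=> ce; apply: lb_le_inf; first by exists (e i0 x), i0.
  by move=> _ [j Dj <-]; exact: ce.
exists q; last by split.
split => [x y|a x a0].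
  rewrite -lerBlDr; apply: (qc x) => i Di; rewrite lerBlDr [leRHS]addrC -lerBlDr.
  apply: (qc y) => j Dj; rewrite lerBlDr [leRHS]addrC.
  by have [k Dk] := eD _ _ x y Di Dj; apply: le_trans; exact: qe.
rewrite -ler_pdivrMl//; apply: (qc x) => i Di; rewrite ler_pdivrMl//.
by have [k Dk] := eZ _ _ x a0 Di; apply: le_trans; exact: qe.
Qed.

Lemma sublinear0 {q} : sublinear q -> q 0 = 0.
Proof.
move=> [qD qZ]; apply/eqP; rewrite eq_le; apply/andP; split.
  have := qZ 2^-1 0; rewrite scaler0 invr_gt0 ltr0n => /(_ isT).
  by rewrite -subr_ge0 => h; lra.
by have := qD 0 0; rewrite addr0 -[leLHS]addr0 lerD2l.
Qed.

Lemma sublinearN {q} x : sublinear q -> - q (- x) <= q x.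
Proof.
move=> /[dup] /sublinear0 q0 [/(_ x (- x)) + _].
by rewrite subrr q0 => h; lra.
Qed.

(** The tilt is the infimum of the right-hand side over [t >= 0]: [t = 0] puts it below [q], and
    [t = 1] at [- y] gives [q' (- y) <= - q y]. *)
Lemma sublinear_tilt {q} y : sublinear q -> exists2 q', sublinear q' &
  forall t x, 0 <= t -> q' x <= q (x + t *: y) - t * q y.
Proof.
move=> /[dup] qs [qD qZ].
have qZ0 t x : 0 <= t -> q (t *: x) <= t * q x.
  rewrite le_eqVlt => /orP[/eqP<-|]; last exact: qZ.
  by rewrite scale0r mul0r sublinear0.
have [||||q' q's [q'e _]] := @sublinear_inf R [set t | 0 <= t]
    (fun t x => q (x + t *: y) - t * q y) (fun x => - q (- x)).
- by exists 0 => /=.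
(* Homogeneity at [t^-1] gives [t * q y <= q (t *: y)], and subadditivity bounds the latter by
   [q (x + t *: y) + q (- x)]. *)
- move=> t x /= t0; have := qD (x + t *: y) (- x); rewrite addrAC subrr add0r.
  have := qZ0 t^-1 (t *: y); rewrite invr_ge0 => /(_ t0).
  have [->|tn0] := eqVneq t 0; first by rewrite scale0r addr0 mul0r sublinear0//; lra.
  rewrite scalerA mulVf// scale1r -ler_pdivrMl ?invr_gt0 ?lt0r ?tn0// invrK; lra.
- move=> s t x z /= s0 t0; exists (s + t); first exact: addr_ge0.
  rewrite scalerDl addrACA; have := qD (x + s *: y) (z + t *: y); lra.
- move=> t a x /= a0 t0; exists (a * t); first by rewrite mulr_ge0// ltW.
  by rewrite -scalerA -scalerDr mulrBr mulrA lerD2r; exact: qZ.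
by exists q' => // t x; exact: q'e.
Qed.

(* A minimal sublinear functional coincides with all its tilts, which makes it
   additive; tilting q first at x0 forces the value at x0. *)
Lemma hahn_banach {q} x0 : sublinear q -> exists2 h : X -> R^o, linear h &
  (forall x, h x <= q x) /\ q x0 <= h x0.
Proof.
move=> qs; have [p ps pe] := sublinear_tilt x0 qs.
pose Q := {r : X -> R | sublinear r /\ forall x, r x <= p x}.
pose le (r s : Q) := `[< forall x, sval s x <= sval r x >].
have p_Q : sublinear p /\ forall x, p x <= p x by [].
have [|||[h [hs hp]] hmin] := @ZL_preorder Q (exist _ p p_Q) le.
- by move=> r; apply/asboolP.
- move=> r s t /asboolP sr /asboolP ts; apply/asboolP => x.
  exact: le_trans (ts x) (sr x).
- move=> C totC; have [->|/set0P C0] := eqVneq C set0; first by exists (exist _ p p_Q).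
  have [|||m ms [me _]] :=
    @sublinear_inf Q C (fun r => sval r) (fun x => - p (- x)) C0.
  + move=> r x Cr; have [rs rp] := svalP r.
    by apply: le_trans (sublinearN x rs); rewrite lerN2.
  + move=> r s x y Cr Cs; have [/asboolP sr|/asboolP rs] := totC _ _ Cr Cs.
      exists s => //; have [[sD _] _] := svalP s.
      by apply: le_trans (sD _ _) _; rewrite lerD2r.
    exists r => //; have [[rD _] _] := svalP r.
    by apply: le_trans (rD _ _) _; rewrite lerD2l.
  + by move=> r a x a0 Cr; exists r => //; have [[_ rZ] _] := svalP r; exact: rZ.
  have [r Cr] := C0; have m_Q : sublinear m /\ forall x, m x <= p x.
    split=> // x; apply: le_trans (me r x Cr) _.
    by have [_] := svalP r; apply.
  exists (exist _ m m_Q) => s Cs; apply/asboolP => x /=; exact: me.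
have h_tilt t x y : 0 <= t -> h x <= h (x + t *: y) - t * h y.
  move=> t0; have [h' h's h'e] := sublinear_tilt y hs.
  have h'_h z : h' z <= h z.
    by have := h'e 0 z (lexx _); rewrite scale0r addr0 mul0r subr0.
  have h'_Q : sublinear h' /\ forall x, h' x <= p x.
    by split=> // z; exact: le_trans (hp z).
  have /asboolP hh' : le (exist _ h' h'_Q) (exist _ h (conj hs hp)).
    by apply: hmin; apply/asboolP.
  exact: le_trans (hh' x) (h'e t x t0).
have [hD hZ] := hs.
have h_add x y : h (x + y) = h x + h y.
  apply/eqP; rewrite eq_le hD /=.
  by have := h_tilt 1 x y ler01; rewrite scale1r mul1r lerBrDr.
have h0 := sublinear0 hs.
have h_opp x : h (- x) = - h x.
  by apply/eqP; rewrite -addr_eq0 -h_add addNr h0.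
have h_pos a x : 0 < a -> h (a *: x) = a * h x.
  move=> a0; apply/eqP; rewrite eq_le hZ//= -ler_pdivlMl//.
  have := hZ a^-1 (a *: x); rewrite invr_gt0 scalerA mulVf ?gt_eqF// scale1r.
  by apply.
have h_scale a x : h (a *: x) = a * h x.
  have [a0|a0|->] := ltgtP a 0; last by rewrite scale0r mul0r.
    by rewrite -{1}[a]opprK scaleNr h_opp h_pos ?oppr_gt0// mulNr opprK.
  exact: h_pos.
exists h; first by move=> a x y; rewrite h_add h_scale.
have pq x : p x <= q x.
  by have := pe 0 x (lexx _); rewrite scale0r addr0 mul0r subr0.
split=> [x|]; first exact: le_trans (hp x) (pq x).
(* At [- x0] with [t = 1] the first tilt is at most [q 0 - q x0], whence [h (- x0) <= - q x0]. *)
have := le_trans (hp (- x0)) (pe 1 (- x0) ler01).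
by rewrite scale1r mul1r addNr (sublinear0 qs) sub0r h_opp lerN2.
Qed.

End HahnBanach.

(** * The dual unit ball *)

Section DualBall.
Context {R : realType} {X : normedModType R}.
Implicit Types (S : set X) (x y t : X).

(** The [sup] in [dual_norm] bounds the values only once they are known to be bounded: continuity at
    0 gives a radius [d], and [2 / d] is a bound on the unit ball. *)
Lemma dual_unit_ball_le (f : X -> R) x : dual_unit_ball X f -> `|f x| <= `|x|.
Proof.
move=> [[flin fcont] fnorm]; have f0 : f 0 = 0.
  by have := flin (-1) 0 0; rewrite scaler0 addr0 scaleN1r addNr.
have fZ a y : f (a *: y) = a * f y.
  by have := flin a y 0; rewrite addr0 f0 addr0.
have [d d0 fd] : exists2 d, 0 < d & forall y, `|y| < d -> `|f y| < 1.
  have /cvgrPdist_lt/(_ _ ltr01) := fcont 0.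
  rewrite -nbhs_nbhs_norm => /= -[d d0 fd]; exists d => // y yd.
  have := fd y; rewrite /= !sub0r normrN => /(_ yd).
  by rewrite f0 sub0r normrN.
have bnd : has_ubound [set `|f x| | x in [set x : X | `|x| <= 1]].
  exists (2 / d) => _ [y /= y1 <-].
  have : `|f ((d / 2) *: y)| < 1.
    apply: fd; rewrite normrZ gtr0_norm ?divr_gt0//.
    by apply: le_lt_trans (ler_piMr _ y1) _; lra.
  rewrite fZ normrM gtr0_norm ?divr_gt0// => h.
  by rewrite ler_pdivlMr//; lra.
have f1 y : `|y| <= 1 -> `|f y| <= 1.
  move=> y1; apply: le_trans fnorm; apply: ub_le_sup => //.
  by exists y.
have [->|x0] := eqVneq x 0; first by rewrite f0 !normr0.
have nx0 : 0 < `|x| by rewrite normr_gt0.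
have := f1 (`|x|^-1 *: x); rewrite normrZ normfV normr_id mulVf ?gt_eqF//.
move=> /(_ (lexx _)); rewrite fZ normrM normfV normr_id.
by rewrite ler_pdivrMl// mulr1.
Qed.

Lemma dual_unit_ballP (f : X -> R) : linear (f : X -> R^o) ->
  (forall x, f x <= `|x|) -> dual_unit_ball X f.
Proof.
move=> flin fle.
have fB y z : f (y - z) = f y - f z.
  by have := flin (-1) z y; rewrite !scaleN1r [- z + y]addrC => ->; rewrite addrC.
have f0 : f 0 = 0 by have := fB 0 0; rewrite !subrr.
have fn x : `|f x| <= `|x|.
  rewrite ler_norml fle andbT lerNl; have := fle (- x).
  by rewrite -sub0r fB f0 !sub0r normrN.
split; first split => //.
  move=> x; apply/cvgrPdist_lt => e e0; apply/nbhs_normP.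
  exists e => //= y xy; rewrite -fB; exact: le_lt_trans (fn _) xy.
apply: ge_sup; first by exists `|f 0|, 0 => //=; rewrite normr0 ler01.
by move=> _ [x /= x1 <-]; exact: le_trans (fn x) x1.
Qed.

(** Hahn-Banach for the distance to the span of [S], a sublinear functional that vanishes on [S],
    lies below the norm and is at least [d] at [x]. *)
Lemma separating_functional S x d : (forall t, linear_span S t -> d <= `|x - t|) ->
  exists h : X -> R, [/\ dual_unit_ball X h, forall z, S z -> h z = 0 & d <= h x].
Proof.
move=> dS.
have [||||q qs [qle qge]] := @sublinear_inf R X X (linear_span S)
  (fun t x => `|x - t|) (fun=> 0).
- by exists 0; exact: span0.
- by move=> t y _; exact: normr_ge0.
- move=> s t y z Ss St; exists (s + t); first exact: spanD.
  by rewrite opprD addrACA ler_normD.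
- move=> t a y a0 St; exists (a *: t); first exact: spanZ.
  by rewrite -scalerBr normrZ gtr0_norm.
have [h hlin [hq hx]] := hahn_banach x qs.
exists h; split.
- apply: dual_unit_ballP => // y; apply: le_trans (hq y) _.
  by have := qle 0 y (span0 S); rewrite subr0.
- have hS z : S z -> h z <= 0.
    move=> Sz; apply: le_trans (hq z) _.
    by have := qle z z (span_mem S z Sz); rewrite subrr normr0.
  move=> z Sz; apply/eqP; rewrite eq_le hS//=.
  have h0 : h 0 = 0 by have := hlin (-1) 0 0; rewrite scaler0 addr0 scaleN1r addNr.
  have hN : h (- z) = - h z by have := hlin (-1) z 0; rewrite !scaleN1r !addr0 h0 addr0.
  rewrite -oppr_le0 -hN; apply: le_trans (hq _) _.
  have := qle (- z) (- z); rewrite subrr normr0; apply.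
  by rewrite -scaleN1r; exact/spanZ/span_mem.
- by apply: le_trans hx; exact: qge.
Qed.

Lemma dual_unit_ball0 : dual_unit_ball X (fun=> 0).
Proof. apply: dual_unit_ballP => [a x y|x] /=; first by rewrite scaler0 addr0.
exact: normr_ge0.
Qed.

(** Closeness on a finite list of points defines a weak* neighbourhood, so it is met by the
    countable dense set, which is then enumerated. *)
Lemma separable_dual_ball_seq : separable_set (dual_unit_ball X) ->
  exists2 g : nat -> X -> R, forall n, dual_unit_ball X (g n) &
    forall f, dual_unit_ball X f -> forall (s : seq X) (e : R), 0 < e ->
      exists n, forall x, x \in s -> `|f x - g n x| < e.
Proof.
move=> [S [cS SB BS]].
have near_seq (f : {ptws X -> R}) (s : seq X) (e : R) : 0 < e ->
    \forall g \near f, forall x, x \in s -> `|f x - g x| < e.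
  move=> e0; have nf := nbhs_filter f; elim: s => [|x s IH].
    by apply: (@filterE _ _ nf) => g x; rewrite in_nil.
  have fx := @proj_continuous X (fun=> R) x f _ (nbhsx_ballx (f x) e e0).
  apply: (@filterS2 _ _ nf _ _ _ _ IH fx) => g gs gx y.
  by rewrite inE => /orP[/eqP->//|]; exact: gs.
have approx (f : {ptws X -> R}) (s : seq X) (e : R) : dual_unit_ball X f -> 0 < e ->
    exists2 g, S g & forall x, x \in s -> `|f x - g x| < e.
  by move=> /BS Sf e0; have [g [Sg ?]] := Sf _ (near_seq f s e e0); exists g.
(* Approximating the zero functional shows that [S] is nonempty; [g0] fills the indices that [k]
   does not take. *)
have [g0 Sg0 _] := approx _ [::] _ dual_unit_ball0 ltr01.
have [k _ kI] := card_le_ex 0%N cS.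
have /choice[g gP] : forall n, exists g, S g /\ forall g', S g' -> k g' = n -> g = g'.
  move=> n; have [[g' [Sg' <-]]|N] := pselect (exists g', S g' /\ k g' = n).
    by exists g'; split => // g2 Sg2 /kI ->//; exact: mem_set.
  by exists g0; split => // g' Sg' kg'; exfalso; apply: N; exists g'.
exists g; first by move=> n; apply: SB; exact: (gP n).1.
move=> f fB s e e0; have [g' Sg' fg'] := approx f s e fB e0.
by exists (k g'); rewrite ((gP (k g')).2 g').
Qed.

End DualBall.

(** * Separated sets *)

Section Separated.
Context {R : realType} {X : normedModType R}.
Implicit Types (Y Z : set X) (x y z t : X) (s : seq X) (e : R).

(** Only one point of each list has to be far from the others. Hence a point far from the whole span
    can be added: it is the witness for every list containing it. *)
Definition separated e Z := forall s, s <> [::] -> (forall z, z \in s -> Z z) ->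
  exists2 z, z \in s & forall t, linear_span ([set` s] `\ z) t -> e <= `|z - t|.

(** Zorn's lemma applies because a finite list in the union of a chain lies in one member; a point
    far from the span of a maximal set could be added to it. *)
Lemma maximal_separated Y e : 0 < e -> exists2 Z, Z `<=` Y /\ separated e Z &
  forall y, Y y -> exists2 t, linear_span Z t & `|y - t| < e.
Proof.
move=> e0; pose P := [set Z | Z `<=` Y /\ separated e Z].
have [|Z [[ZY Zsep] Zmax]] := @Zorn_bigcup _ P.
  move=> F FP totF; split; first by move=> x [Z /FP[ZY _]]; exact: ZY.
  move=> s s0 sF.
  have [Z FZ sZ] : exists2 Z, F Z & forall z, z \in s -> Z z.
    elim: s s0 sF => // x s IH _ xsF.
    have [Z FZ Zx] := xsF x (mem_head _ _).
    have [s0|/eqP s0] := eqVneq s [::].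
      by exists Z => // z; rewrite s0 inE => /eqP->.
    have [|W FW sW] := IH s0; first by move=> z zs; apply: xsF; rewrite inE zs orbT.
    have [ZW|WZ] := totF _ _ FZ FW.
      by exists W => // z; rewrite inE => /orP[/eqP->|/sW//]; exact: ZW.
    by exists Z => // z; rewrite inE => /orP[/eqP->//|/sW]; exact: WZ.
  by have [_] := FP _ FZ; apply.
exists Z => // y Yy; have [Zy|NZy] := pselect (Z y).
  by exists y; [exact: span_mem|rewrite subrr normr0].
apply/not_notP => far.
have {}far t : linear_span Z t -> e <= `|y - t|.
  by move=> Zt; rewrite leNgt; apply/negP => lt_e; apply: far; exists t.
apply: (Zmax (Z `|` [set y])).
  split; first by left.
  by move=> h; apply: NZy; apply: h; right.
split; first by move=> x [/ZY//|->].
move=> s s0 sZy; have [ys|Nys] := boolP (y \in s).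
  exists y => // t; move/(spanS (S' := Z)) => h; apply: far; apply: h.
  by move=> x [/= /sZy[|->]].
by apply: Zsep => // z zs; have [//|zy] := sZy z zs; rewrite -zy zs in Nys.
Qed.

(** The constant depends only on the number of points. With [z] far from the others and
    [x = a *: z + t], one has [|a| <= |x| / e] and [|t| <= |x| * (1 + M / e)]; induction on [t]
    gives the recursion for [C]. *)
Lemma separated_functional_bound e M Z : 0 < e -> 0 <= M -> separated e Z ->
    (forall z, Z z -> `|z| <= M) ->
  exists2 C : nat -> R, forall m, 0 <= C m &
    forall m s (f : X -> R) eta, (size s <= m)%N -> (forall z, z \in s -> Z z) ->
      linear (f : X -> R^o) -> 0 <= eta -> (forall z, z \in s -> `|f z| <= eta) ->
      forall x, linear_span [set` s] x -> `|f x| <= C m * eta * `|x|.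
Proof.
move=> e0 M0 Zsep ZM.
pose C := fix C m : R := if m is n.+1 then C n * (1 + M / e) + e^-1 else 0.
have C0 m : 0 <= C m.
  elim: m => //= m IH; rewrite addr_ge0 ?invr_ge0 ?(ltW e0)//.
  by rewrite mulr_ge0// addr_ge0// divr_ge0// ltW.
exists C => // m s f eta sm sZ flin eta0 feta.
have f0 : f 0 = 0.
  by have := flin (-1) 0 0; rewrite scaler0 addr0 scaleN1r addNr.
elim: m s sm sZ feta => [|m IH] s sm sZ feta x.
  move: sm; rewrite leqn0 => /nilP -> /span_nil ->.
  by rewrite f0 !normr0 mulr0.
have [->|/eqP s0] := eqVneq s [::].
  move=> /span_nil ->.
  by rewrite f0 !normr0 mulr0.
have [z zs zfar] := Zsep s s0 sZ.
move=> /(span_setD1 _ z)[a [t [st ->]]] {x}.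
set x := a *: z + t.
have ax : `|a| * e <= `|x|.
  have [->|a0] := eqVneq a 0; first by rewrite normr0 mul0r.
  have -> : x = a *: (z - (- a^-1 *: t)).
    by rewrite scaleNr opprK scalerDr scalerA divff// scale1r.
  rewrite normrZ ler_wpM2l//; apply: zfar; exact: spanZ.
have {}ax : `|a| <= `|x| / e by rewrite ler_pdivlMr.
have tx : `|t| <= `|x| * (1 + M / e).
  have -> : t = x - a *: z by rewrite /x addrC addKr.
  apply: le_trans (ler_normB _ _) _; rewrite normrZ mulrDr mulr1 lerD2l.
  apply: le_trans (ler_wpM2l _ (ZM _ (sZ _ zs))) _ => //.
  by rewrite mulrA mulrAC; exact: ler_wpM2r.
have ft : `|f t| <= C m * eta * `|t|.
  apply: (IH [seq y <- s | y != z]).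
  - rewrite -ltnS (leq_trans _ sm)// size_filter -(count_predC (pred1 z)) addnC.
    rewrite -[ltnLHS]addn0 ltn_add2l -has_count.
    by apply/hasP; exists z => /=.
  - by move=> y; rewrite mem_filter => /andP[_]; exact: sZ.
  - by move=> y; rewrite mem_filter => /andP[_]; exact: feta.
  - by apply: spanS st => y [/= ys /eqP yz]; rewrite mem_filter yz.
rewrite {1}/x flin; apply: le_trans (ler_normD _ _) _.
have -> : C m.+1 * eta * `|x| =
    `|x| / e * eta + C m * eta * (`|x| * (1 + M / e)) by rewrite /=; ring.
apply: lerD; first by rewrite normrM ler_pM//; exact: feta.
by apply: le_trans ft _; rewrite ler_wpM2l// mulr_ge0.
Qed.

(** If [x] is the far point of the pair, [e] itself is a bound. If [z] is, the distance is at least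
    [|a| * e] and [e - |a| * M]; adding these with weights [M] and [e] eliminates [a]. *)
Lemma separated_dist_line e M Z x z a : 0 < e -> separated e Z -> Z x -> Z z ->
  x <> z -> `|z| <= M -> e ^+ 2 / (e + M) <= `|x - a *: z|.
Proof.
move=> e0 Zsep Zx Zz xz zM; have M0 : 0 <= M by exact: le_trans zM.
have ex : e <= `|x|.
  have [//|y|y] := Zsep [:: x]; first by rewrite inE => /eqP->.
  rewrite inE => /eqP-> /(_ 0 (span0 _)).
  by rewrite subr0.
have eM : 0 < e + M by rewrite ltr_pwDl.
rewrite ler_pdivrMr// expr2.
have [//|y|y] := Zsep [:: x; z]; first by rewrite !inE => /orP[/eqP->|/eqP->].
rewrite !inE => /orP[/eqP->|/eqP->] far.
  have : e <= `|x - a *: z|.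
    apply: far; apply/spanZ/span_mem; split; first by rewrite /= !inE eqxx orbT.
    by move=> zx; exact: xz.
  move=> h; apply: ler_pM => //; try exact: ltW.
  by rewrite lerDl.
have far1 : `|a| * e <= `|x - a *: z|.
  have [->|a0] := eqVneq a 0; first by rewrite normr0 mul0r.
  have -> : x - a *: z = - a *: (z - a^-1 *: x).
    by rewrite scaleNr scalerBr scalerA divff// scale1r opprB.
  rewrite normrZ normrN ler_wpM2l//; apply: far; apply/spanZ/span_mem.
  by split => //; rewrite /= !inE eqxx.
have far2 : e - `|a| * M <= `|x - a *: z|.
  apply: le_trans (lerB_dist _ _); rewrite normrZ; apply: lerB => //.
  exact: ler_wpM2l.
have := ler_wpM2r M0 far1; have := ler_wpM2l (ltW e0) far2.
by lra.
Qed.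

End Separated.

(** * The partial order *)

Section Forcing.
Context {R : realType} {X : normedModType R}.
Implicit Types (A B : {fset nat * X}) (x z t : X) (n : nat).

Definition fset_section A n : seq X := [seq p.2 | p <- A & p.1 == n].

Lemma mem_section A n z : (z \in fset_section A n) = ((n, z) \in A).
Proof.
apply/mapP/idP => [[[k y]]|nzA]; first by rewrite mem_filter /= => /andP[/eqP-> ?] ->.
by exists (n, z) => //; rewrite mem_filter /= eqxx.
Qed.

Lemma size_section A n : (size (fset_section A n) <= #|` A|)%N.
Proof. by rewrite size_map size_filter count_size. Qed.

Lemma fset_fst_bound A : exists N, forall n z, (n, z) \in A -> (n < N)%N.
Proof.
exists (\max_(p <- A) p.1).+1 => n z nzA; rewrite ltnS.
exact: (leq_bigmax_seq (F := fun p => p.1) (n, z)).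
Qed.

Context {Z : set X} {x0 : X} {c : R}.
Hypothesis c0 : 0 < c.
Hypothesis cZ : forall z a, Z z -> 2 * c <= `|x0 - a *: z|.

(** The bound [d] expresses that the distance to the span exceeds [c] without forming an infimum. *)
Definition far (s : seq X) :=
  exists2 d, c < d & forall t, linear_span [set` s] t -> d <= `|x0 - t|.

Definition condition A :=
  (forall n z, (n, z) \in A -> Z z) /\ forall n, far (fset_section A n).

Context {C : nat -> R} {g : nat -> X -> R}.
Hypothesis C0 : forall m, 0 <= C m.
Hypothesis C_bound : forall m s (f : X -> R) eta, (size s <= m)%N ->
  (forall z, z \in s -> Z z) -> linear (f : X -> R^o) -> 0 <= eta ->
  (forall z, z \in s -> `|f z| <= eta) ->
  forall x, linear_span [set` s] x -> `|f x| <= C m * eta * `|x|.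
Hypothesis g_ball : forall n, dual_unit_ball X (g n).
Hypothesis g_dense : forall f, dual_unit_ball X f ->
  forall (s : seq X) (e : R), 0 < e ->
  exists n, forall x, x \in s -> `|f x - g n x| < e.

Let del (j : nat) : R := j.+1%:R^-1.

(** Chosen so that a functional of size [eta m j] on at most [2 * m] points has value at most
    [del j] at vectors of their span of norm at most [|x0| + c + 1]. *)
Let eta (m j : nat) : R := del j / ((C (m + m) + 1) * (`|x0| + c + 1)).

Let del_gt0 j : 0 < del j. Proof. by rewrite invr_gt0. Qed.

Let del_le1 j : del j <= 1. Proof. by rewrite invf_le1// ler1n. Qed.

Let eta_gt0 m j : 0 < eta m j.
Proof.
rewrite divr_gt0// mulr_gt0//; first by rewrite ltr_wpDl.
by rewrite ltr_wpDl// addr_ge0// ltW.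
Qed.

(* A label (m, j, l) bounds the size by m and the gap over c by del j; the entry
   l_n is the index of the functional witnessing farness of the n-th section. *)
Definition has_label A (lab : nat * nat * seq nat) :=
  let: (m, j, l) := lab in
  [/\ (#|` A| <= m)%N,
      forall n z, (n, z) \in A -> (n < size l)%N &
      forall n, (n < size l)%N -> c + 2 * del j <= g (nth 0%N l n) x0 /\
        forall z, (n, z) \in A -> `|g (nth 0%N l n) z| <= eta m j].

(** The shared functional [f] is tiny on both sections, hence on vectors [t] of moderate norm in the
    joint span, and [f (x0 - t)] is at least [c + 2 * del j - del j]. Beyond the length of [l] the
    sections are empty. *)
Lemma linked A B lab : condition A -> condition B ->
  has_label A lab -> has_label B lab -> condition (A `|` B)%fset.
Proof.
move: lab => [[m j] l] [AZ Afar] [BZ Bfar] [mA lA gA] [mB lB gB].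
have ABZ n z : (n, z) \in (A `|` B)%fset -> Z z.
  by rewrite inE => /orP[/AZ|/BZ].
split=> // n; have [ln|nl] := leqP (size l) n.
  have [d cd dn] := Afar n; exists d => // t tn; apply: dn; apply: spanS tn => z /=.
  by rewrite !mem_section inE => /orP[//|/lB]; rewrite ltnNge ln.
exists (c + del j); first by rewrite ltrDl.
move=> t tn; have [gx0 gAz] := gA n nl; have [_ gBz] := gB n nl.
set f := g (nth 0%N l n) in gx0 gAz gBz.
have f_ball : dual_unit_ball X f by exact: g_ball.
have flin : linear (f : X -> R^o) by case: f_ball => -[].
(* For large [t] the triangle inequality alone gives a distance above [c + 1]. *)
have [t_le|t_gt] := leP `|t| (`|x0| + c + 1); last first.
  have := lerB_dist t x0; rewrite distrC; have := del_le1 j; lra.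
have ft : `|f t| <= C (m + m)%N * eta m j * `|t|.
  apply: (C_bound (m + m)%N (fset_section (A `|` B)%fset n)) => //.
  - apply: leq_trans (size_section _ _) _; rewrite cardfsU.
    by apply: leq_trans (leq_subr _ _) _; exact: leq_add.
  - by move=> z; rewrite mem_section; exact: ABZ.
  - exact: ltW.
  - by move=> z; rewrite mem_section inE => /orP[/gAz|/gBz].
have Ct : C (m + m)%N * eta m j * `|t| <= del j.
  have Cp : 0 < C (m + m)%N + 1 by rewrite ltr_wpDl.
  have xp : 0 < `|x0| + c + 1 by rewrite ltr_wpDl// addr_ge0// ltW.
  have -> : del j = (C (m + m)%N + 1) * eta m j * (`|x0| + c + 1).
    by rewrite /eta; field; rewrite !gt_eqF.
  apply: ler_pM => //; first by rewrite mulr_ge0// ltW.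
  by rewrite ler_wpM2r ?lerDl// ltW.
have fxt : f (x0 - t) = f x0 - f t.
  by have := flin (-1) t x0; rewrite !scaleN1r [- t + x0]addrC => ->; rewrite addrC.
have := dual_unit_ball_le f (x0 - t) f_ball; rewrite fxt.
have := ler_norm (f x0 - f t); have := ler_norm (f t); lra.
Qed.

(** The finitely many indices below [N] share a gap [3 * del j] over [c]. A separating functional
    vanishes on the section; replacing it by a nearby [g i] costs one [del j] at [x0]. *)
Lemma exists_label A : condition A -> exists lab, has_label A lab.
Proof.
move=> [AZ Afar].
have [N NA] : exists N, forall n z, (n, z) \in A -> (n < N)%N.
  exact: fset_fst_bound.
have [j jN] : exists j, forall n, (n < N)%N -> exists2 d, c + 3 * del j < d &
    forall t, linear_span [set` fset_section A n] t -> d <= `|x0 - t|.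
  elim: N {NA} => [|N [j jN]]; first by exists 0%N.
  have [d cd dN] := Afar N.
  have [k kd] : exists k, c + 3 * del k < d.
    have [|k] := @ltr_add_invr R 0 ((d - c) / 3); first by rewrite divr_gt0// subr_gt0.
    rewrite add0r -/(del k) => kd; exists k; move: (del k) kd => u.
    by rewrite ltr_pdivlMr//; lra.
  have anti i i' : (i <= i')%N -> del i' <= del i.
    by move=> ii'; rewrite lef_pV2 ?posrE// ler_nat.
  exists (maxn j k) => n; rewrite ltnS leq_eqVlt => /orP[/eqP->|/jN[d' d'j d'n]].
    by exists d => //; have := anti _ _ (leq_maxr j k); lra.
  by exists d' => //; have := anti _ _ (leq_maxl j k); lra.
have /choice[i iP] : forall n, exists i, (n < N)%N -> c + 2 * del j <= g i x0 /\
    forall z, (n, z) \in A -> `|g i z| <= eta #|` A| j.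
  move=> n; have [nN|_] := ltnP n N; last by exists 0%N.
  have [d cd dn] := jN n nN.
  have [h [hball h0 hx0]] := separating_functional _ _ _ dn.
  have e0 : 0 < Num.min (del j) (eta #|` A| j) by rewrite lt_min del_gt0 eta_gt0.
  have [i hi] := g_dense h hball (x0 :: fset_section A n) _ e0.
  exists i => _; split.
    have := hi x0 (mem_head _ _); rewrite lt_min => /andP[+ _].
    have := ler_norm (h x0 - g i x0); lra.
  move=> z nzA; have zs : z \in fset_section A n by rewrite mem_section.
  have := hi z; rewrite inE zs orbT lt_min => /(_ isT)/andP[_].
  by rewrite h0// sub0r normrN => /ltW.
exists (#|` A|, j, mkseq i N); split; rewrite ?size_mkseq// => n nN.
by rewrite nth_mkseq//; exact: iP.
Qed.

(** * The order of conditions and its generic filters *)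

(** The Boolean predicate makes conditions equal as soon as their finite sets are, as antisymmetry
    requires. *)
Definition forcing := {A | `[< condition A >]}.

Definition forcing_of A (condA : condition A) : forcing :=
  exist (fun A => is_true `[< condition A >]) A (asboolT condA).

Lemma forcingP (p : forcing) : condition (val p).
Proof. exact/asboolP/(valP p). Qed.

Definition forcing_le (p q : forcing) : Prop := (val q `<=` val p)%fset.

Lemma forcing_partial_order : is_partial_order forcing_le.
Proof.
split.
- by move=> p; exact: fsubset_refl.
- move=> p q pq qp; apply: val_inj; apply/eqP.
  by rewrite eqEfsubset; apply/andP.
- by move=> p q r pq qr; exact: fsubset_trans qr pq.
Qed.

(** There are countably many labels, and [linked] makes the labelling injective on an antichain. *)
Lemma forcing_ccc : ccc forcing_le.
Proof.
move=> F antiF.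
have /choice[lab labP] : forall p : forcing, exists lab, has_label (val p) lab.
  by move=> p; apply: exists_label; exact: forcingP.
apply/countable_injP; exists (choice.pickle \o lab) => p q /set_mem Fp /set_mem Fq /=.
move=> /(pcan_inj choice.pickleK) pq; apply/not_notP => npq.
apply: (antiF p q Fp Fq npq).
have pq_cond : condition (val p `|` val q)%fset.
  apply: (linked _ _ (lab p)); [exact: forcingP|exact: forcingP|by []|].
  by rewrite pq.
exists (forcing_of _ pq_cond); split; [exact: fsubsetUl|exact: fsubsetUr].
Qed.

(** The factor 2 in [cZ] provides the strict gap over [c]; the list may also be empty. *)
Lemma far_sub1 (s : seq X) z : Z z -> (forall y, y \in s -> y = z) -> far s.
Proof.
move=> Zz sz; exists (2 * c); first by rewrite ltr_pMl// ltr1n.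
move=> t st; have [a ->] : exists a, t = a *: z.
  by apply: span_set1; apply: spanS st => y /= /sz.
exact: cZ.
Qed.

Definition forcing_meets z : set forcing := 
  [set p | exists n, (n, z) \in (val p : {fset nat * X})].

(** The point [z] is put into a fresh section [N], where it stands alone; the other sections do not
    change. *)
Lemma forcing_meets_dense z : Z z -> order_dense forcing_le (forcing_meets z).
Proof.
move=> Zz p; have [pZ pfar] := forcingP p.
have [N pN] : exists N, forall n y, (n, y) \in val p -> (n < N)%N.
  exact: fset_fst_bound.
have cond : condition ((N, z) |` val p)%fset.
  split=> [n y|n].
    by rewrite !inE => /orP[/eqP[_ ->]//|/pZ].
  have [->|nN] := eqVneq n N.
    apply: (far_sub1 _ z) => // y; rewrite mem_section !inE.
    by move=> /orP[/eqP[]//|/pN]; rewrite ltnn.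
  have [d cd dn] := pfar n; exists d => // t tn; apply: dn; apply: spanS tn => y /=.
  by rewrite !mem_section !inE xpair_eqE (negbTE nN).
exists (forcing_of _ cond); first by exists N; rewrite /= !inE eqxx.
exact: fsubsetU1.
Qed.

(** [H n] is the union of the [n]-th sections over the filter. A vector of its span involves
    finitely many points, which directedness collects in a single condition. *)
Lemma forcing_generic : MA R -> card_lt Z [set: R] -> Z !=set0 ->
  exists H : nat -> set X, [/\ forall n, H n `<=` Z, Z `<=` \bigcup_n H n &
    forall n t, linear_span (H n) t -> c <= `|x0 - t|].
Proof.
move=> ma [ZR NRZ] [z0 Zz0].
have cond0 : condition fset0.
  split=> [n z|n]; first by rewrite in_fset0.
  by apply: (far_sub1 _ z0 Zz0) => y; rewrite mem_section in_fset0.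
have [||G [G0 _ Gdir] Gmeets] := ma forcing forcing_le
    (inhabits (forcing_of _ cond0)) forcing_partial_order forcing_ccc
    [set forcing_meets z | z in Z].
- split; first exact: card_le_trans (card_image_le _ _) ZR.
  by move=> h; apply: NRZ; apply: card_le_trans h (card_image_le _ _).
- by move=> D [z Zz <-]; exact: forcing_meets_dense.
exists (fun n => [set z | exists2 p : forcing, G p &
  (n, z) \in (val p : {fset nat * X})]); split.
- by move=> n z [p _]; have [pZ _] := forcingP p; exact: pZ.
- move=> z Zz; have [|p [[n nz] Gp]] := Gmeets (forcing_meets z); first by exists z.
  by exists n => //; exists p.
- move=> n t /span_finite[s sH st].
  have [p Gp sp] : exists2 p, G p & forall z, z \in s -> (n, z) \in val p.
    elim: s sH {st} => [|z s IH] sH; first by have [p Gp] := G0; exists p.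
    have [|p Gp sp] := IH; first by move=> y ys; apply: sH; rewrite inE ys orbT.
    have [q Gq zq] := sH z (mem_head _ _).
    have [r Gr [rp rq]] := Gdir _ _ Gp Gq; exists r => // y.
    rewrite inE => /orP[/eqP->|/sp yp]; first exact: (fsubsetP rq).
    exact: (fsubsetP rp).
  have [_ /(_ n)[d cd dn]] := forcingP p.
  apply: le_trans (ltW cd) _; apply: dn; apply: spanS st => z /= /sp.
  by rewrite mem_section.
Qed.

End Forcing.

(** * Density *)

Section Density.
Context {R : realType} {X : normedModType R}.
Implicit Types (D S W Y Z : set X) (x y z t : X).

Lemma denseP D :
  dense D <-> forall x (e : R), 0 < e -> exists2 d, D d & `|x - d| < e.
Proof.
split=> [Ddense x e e0|Dapprox O [x Ox] Oopen].
  have [|d [xd Dd]] := Ddense (ball x e) _ (ball_open x e).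
    by exists x; exact: ballxx.
  by exists d => //; rewrite -ball_normE in xd.
have /nbhs_ballP[e /= e0 eO] := open_nbhs_nbhs (conj Oopen Ox).
have [d Dd xd] := Dapprox x e e0; exists d; split=> //.
by apply: eO; rewrite -ball_normE.
Qed.

(** Rational combinations of [m] terms, built so that each level is an image of a product of small
    sets when [W] is small. *)
Fixpoint rat_span W m : set X :=
  if m is n.+1 then
    (fun p : rat * (X * X) => ratr p.1 *: p.2.1 + p.2.2) @`
      ([set: rat] `*` (W `*` rat_span W n))
  else [set 0].

Lemma rat_span_approx W x (e : R) : linear_span W x -> 0 < e ->
  exists2 b, (\bigcup_m rat_span W m) b & `|x - b| < e.
Proof.
move=> Wx; move: x Wx e; apply: span_ind => [|a w x Ww _ IH] e e0.
  by exists 0; [exists 0%N|rewrite subrr normr0].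
have [|b [m _ bm] xb] := IH (e / 2); first by rewrite divr_gt0.
(* Adding 1 covers the case [w = 0], since the norm will be a divisor. *)
have w0 : 0 < `|w| + 1 by rewrite ltr_wpDl.
have [|q] := @rat_in_itvoo R a (a + e / 2 / (`|w| + 1)).
  by rewrite ltrDl !divr_gt0.
rewrite in_itv /= => /andP[aq qa].
exists (ratr q *: w + b); first by exists m.+1 => //; exists (q, (w, b)).
rewrite opprD addrACA -scalerBl; apply: le_lt_trans (ler_normD _ _) _.
rewrite normrZ [e]splitr; apply: ler_ltD => //.
rewrite ltr0_norm ?subr_lt0// opprB.
apply: (@le_trans _ _ ((ratr q - a) * (`|w| + 1))).
  by rewrite ler_wpM2l ?subr_ge0 ?lerDl// ltW.
by rewrite -ler_pdivlMr// lerBlDl ltW.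
Qed.

Lemma small_rat_span {T} {K : set T} W : uncountable_cofinality K ->
  small K W -> small K (\bigcup_m rat_span W m).
Proof.
move=> cofK Ws; apply: (small_bigcup cofK); elim=> [|m IH].
  exact/(small_countable cofK)/countable1.
apply: small_image; apply: (small_setX cofK); last exact: (small_setX cofK).
exact/(small_countable cofK)/countableP.
Qed.

Lemma separated_not_small {T} {K : set T} Y : uncountable_cofinality K ->
  (forall D, dense D -> K #<= D) -> linearly_dense Y ->
  exists e : R, exists2 Z, 0 < e /\ separated e Z & Z `<=` Y /\ K #<= Z.
Proof.
move=> cofK Kdense /denseP Ydense.
have k0 (k : nat) : 0 < k.+1%:R^-1 :> R by rewrite invr_gt0.
have /choice[Z ZP] : forall k : nat, exists Z, [/\ Z `<=` Y,
    separated (k.+1%:R^-1) Z & forall y, Y y ->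
    exists2 t, linear_span Z t & `|y - t| < k.+1%:R^-1].
  by move=> k; have [Z [? ?] ?] := maximal_separated Y _ (k0 k); exists Z.
apply/not_notP => N.
have Zs k : small K (Z k).
  move=> KZ; apply: N; have [ZY Zsep _] := ZP k.
  by exists (k.+1%:R^-1), (Z k).
pose W := \bigcup_k Z k.
(* It remains to see that the rational span of [W] is dense: then [K] would embed in a small set. *)
apply: (small_rat_span W cofK (small_bigcup cofK _ Zs)); apply: Kdense.
have W_Y y (e : R) : Y y -> 0 < e -> exists2 w, linear_span W w & `|y - w| < e.
  move=> Yy e0; have [k] := ltr_add_invr e0; rewrite add0r => ke.
  have [_ _ /(_ y Yy)[t Zt yt]] := ZP k.
  exists t; last exact: lt_trans ke.
  by apply: spanS Zt => x Zx; exists k.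
have W_spanY y (e : R) : linear_span Y y -> 0 < e ->
    exists2 w, linear_span W w & `|y - w| < e.
  move=> Yy; move: y Yy e; apply: span_ind => [|a y x Yy _ IH] e e0.
    by exists 0; [exact: span0|rewrite subrr normr0].
  have [|w Ww xw] := IH (e / 2); first by rewrite divr_gt0.
  have a0 : 0 < `|a| + 1 by rewrite ltr_wpDl.
  have [|v Wv yv] := W_Y y (e / 2 / (`|a| + 1)) Yy; first by rewrite !divr_gt0.
  exists (a *: v + w); first by apply: spanD => //; exact: spanZ.
  rewrite opprD addrACA -scalerBr; apply: le_lt_trans (ler_normD _ _) _.
  rewrite normrZ [e]splitr; apply: ler_ltD => //.
  apply: (@le_trans _ _ ((`|a| + 1) * `|y - v|)).
    by rewrite ler_wpM2r ?lerDl.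
  by rewrite mulrC -ler_pdivlMr// ltW.
apply/denseP => x e e0.
(* The error is split as [e / 2] for reaching the span of [Y], and [e / 4] each for the span of [W]
   and its rational part. *)
have e20 : 0 < e / 2 by rewrite divr_gt0.
have e40 : 0 < e / 2 / 2 by rewrite divr_gt0.
have [y Yy xy] := Ydense x _ e20.
have [w Ww yw] := W_spanY y _ Yy e40.
have [b Bb wb] := rat_span_approx W w _ Ww e40.
exists b => //; have -> : x - b = (x - y) + ((y - w) + (w - b)).
  by rewrite addrA subrKA addrA subrK.
apply: le_lt_trans (ler_normD _ _) _; rewrite [e]splitr; apply: ltrD => //.
apply: le_lt_trans (ler_normD _ _) _.
by rewrite [e / 2]splitr; exact: ltrD.
Qed.

End Density.

(** * A linearly dense section that stays away from a point *)

Theorem theorem19 (R : realType) (hMA : MA R) (hCH : ~ CH R)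
    (X : completeNormedModType R) (hinf : infinite_dimensional X)
    (T : Type) (kappa : set T) (hdens : has_density X kappa)
    (hlt : card_lt kappa [set: R]) (hcof : uncountable_cofinality kappa)
    (hsep : separable_set (dual_unit_ball X)) :
  ~ exists Y : set X, overcomplete Y.
Proof.
move=> [Y [[[D1 D1dense D1Y] Ydens] Yover]].
have [[D2 D2dense D2K] Kdens] := hdens.
(* Both sets represent the density of [X], so each embeds in the other. *)
have KY : kappa #<= Y.
  by apply: card_le_trans (Kdens _ D1dense) _; move: D1Y; rewrite card_eq_le => /andP[].
have YK : Y #<= kappa.
  by apply: card_le_trans (Ydens _ D2dense) _; move: D2K; rewrite card_eq_le => /andP[].
have over Z : Z `<=` Y -> kappa #<= Z -> linearly_dense Z.
  move=> ZY KZ; apply: Yover => //; rewrite card_eq_le.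
  by rewrite subset_card_le//=; exact: card_le_trans KZ.
have Ydense : linearly_dense Y by exact: over KY.
have [e [Z1 [e0 Z1sep] [Z1Y KZ1]]] := separated_not_small Y hcof Kdens Ydense.
have [x0 Z1x0] : Z1 !=set0.
  apply/set0P/eqP => Z10; apply: (small_countable hcof (set0 : set X)) => //.
  by rewrite -Z10.
have [M [M0 KM]] : exists M : R, 0 <= M /\
    kappa #<= [set z | [/\ Z1 z, x0 <> z & `|z| <= M]].
  (* The point [x0] and countably many norm-bounded pieces cover [Z1]; the piece of size [kappa]
     cannot be the singleton. *)
  pose F n := if n is m.+1 then [set z | [/\ Z1 z, x0 <> z & `|z| <= m%:R]]
    else [set x0].
  have [|[|n] KF] := bigcup_not_small hcof Z1 F KZ1.
  - move=> z Z1z; have [->|zx0] := eqVneq z x0; first by exists 0%N.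
    (* Index [m.+1] carries the bound [m], here the truncated norm plus one. *)
    exists (Num.truncn `|z|).+2 => //; split=> //.
      by move=> x0z; rewrite x0z eqxx in zx0.
    exact/ltW/truncnS_gt.
  - by case: (small_countable hcof _ (countable1 x0)).
  - by exists n%:R.
set Z := (X in _ #<= X) in KM.
have Z0 : Z !=set0.
  apply/set0P/eqP => Z0; apply: (small_countable hcof (set0 : set X)) => //.
  by rewrite -Z0.
(* Half the bound of [separated_dist_line], so that lines through points of [Z] are at distance at
   least [2 * c] from [x0]. *)
pose c := e ^+ 2 / (e + M) / 2.
have c0 : 0 < c by rewrite !divr_gt0 ?exprn_gt0// ltr_pwDl.
have ZZ1 : Z `<=` Z1 by move=> z [].
have cZ z a : Z z -> 2 * c <= `|x0 - a *: z|.
  move=> [Z1z xz zM]; rewrite /c mulrC divfK//.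
  exact: (separated_dist_line _ _ Z1).
have Zsep : separated e Z by move=> s s0 sZ; apply: Z1sep => // z /sZ /ZZ1.
have [|C C0 C_bound] := separated_functional_bound e M Z e0 M0 Zsep.
  by move=> z [].
have [g g_ball g_dense] := separable_dual_ball_seq hsep.
have ZR : card_lt Z [set: R].
  have ZK : Z #<= kappa.
    by apply: card_le_trans YK; apply: subset_card_le => z /ZZ1 /Z1Y.
  split; first by apply: card_le_trans ZK _; case: hlt.
  by move=> RZ; case: hlt => _; apply; exact: card_le_trans ZK.
have [H [HZ ZH Hfar]] :=
  forcing_generic c0 cZ C0 C_bound g_ball g_dense hMA ZR Z0.
(* Overcompleteness makes this [H n] linearly dense, although its span stays at distance at least
   [c] from [x0]. *)
have [n KH] := bigcup_not_small hcof Z H KM ZH.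
have HY : H n `<=` Y by move=> z /HZ /ZZ1 /Z1Y.
have /denseP/(_ x0 c c0)[t Ht] := over _ HY KH.
by rewrite ltNge (Hfar n t Ht).
Qed.
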